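(* Let $\mathcal{A}$ be a Grothendieck category with a generator $U$, and let $R=\mathrm{End}_{\mathcal{A}}(U)$. Let $S=\mathrm{Hom}_{\mathcal{A}}(U,-):\mathcal{A}\to \mathrm{Mod}(R)$ and let $T:\mathrm{Mod}(R)\to \mathcal{A}$ be a left adjoint of $S$. Let $M$ and $N$ be objects of $\mathcal{A}$. Then $N$ is an $M$-CS-Rickart object of $\mathcal{A}$ if and only if $S(N)$ is an $S(M)$-CS-Rickart right $R$-module.
   Context: In an abelian category: a morphism $s:A\to B$ is a section if there is $s':B\to A$ with $s's=1_A$. A monomorphism $f:X\to Y$ is essential if for every morphism $h:Y\to P$ such that $hf$ is a monomorphism, $h$ is a monomorphism. For objects $M,N$ of an abelian category, $N$ is $M$-CS-Rickart if for every morphism $f:M\to N$ there are an essential monomorphism $e:\mathrm{Ker}(f)\to L$ and a section $s:L\to M$ with $\ker(f)=se$. $\mathrm{Mod}(R)$ denotes the category of right $R$-modules; for modules, $M$-CS-Rickart is understood in $\mathrm{Mod}(R)$. *)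

(* Defs.v *)
From HB Require Import structures.
From mathcomp Require Import all_boot all_order all_algebra.
From mathcomp Require Import boolp.

Set Implicit Arguments.
Unset Strict Implicit.
Unset Printing Implicit Defensive.

Import GRing.Theory.
Local Open Scope ring_scope.

Reserved Notation "g \oc f" (at level 40, left associativity).

(* The universe of small types: by construction the one in which the carriers
   of zmodTypes live.  Indexing coproducts and direct limits by types of this
   universe only, rather than by an unconstrained Type, is what makes them
   small relative to the hom-sets below. *)
Definition small := Type@{Algebra.Zmodule.axioms_.u0}.

(* Preadditive categories.  Hom-sets are abelian groups, as MathComp
   zmodTypes; the decidable equality and choice operator these carry are no
   restriction, since classically every type has them (boolp).  The type
   of objects lives in a larger universe than the hom-sets. *)
Record category := Category {
  obj :> Type;
  mor : obj -> obj -> zmodType;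
  idm : forall X, mor X X;
  mcomp : forall X Y Z, mor Y Z -> mor X Y -> mor X Z;
  mcompA : forall X Y Z W (h : mor Z W) (g : mor Y Z) (f : mor X Y),
    mcomp h (mcomp g f) = mcomp (mcomp h g) f;
  mcomp1m : forall X Y (f : mor X Y), mcomp (idm Y) f = f;
  mcompm1 : forall X Y (f : mor X Y), mcomp f (idm X) = f;
  mcompDl : forall X Y Z (g g' : mor Y Z) (f : mor X Y),
    mcomp (g + g') f = mcomp g f + mcomp g' f;
  mcompDr : forall X Y Z (g : mor Y Z) (f f' : mor X Y),
    mcomp g (f + f') = mcomp g f + mcomp g f'
}.
Arguments mor {c} X Y.
Arguments idm {c} X.
Arguments mcomp {c X Y Z} g f.
Notation "g \oc f" := (mcomp g f).

Section Morphisms.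
Variable A : category.

Definition mono (X Y : A) (f : mor X Y) : Prop :=
  forall (Z : A) (u v : mor Z X), f \oc u = f \oc v -> u = v.

Definition epi (X Y : A) (f : mor X Y) : Prop :=
  forall (Z : A) (u v : mor Y Z), u \oc f = v \oc f -> u = v.

Definition is_section (X Y : A) (s : mor X Y) : Prop :=
  exists s' : mor Y X, s' \oc s = idm X.

Definition essential_mono (X Y : A) (f : mor X Y) : Prop :=
  mono f /\ forall (P : A) (h : mor Y P), mono (h \oc f) -> mono h.

(* k : K -> X is a kernel of f : X -> Y *)
Definition is_kernel (X Y : A) (f : mor X Y) (K : A) (k : mor K X) : Prop :=
  f \oc k = 0 /\
  forall (Z : A) (g : mor Z X), f \oc g = 0 ->
    exists! u : mor Z K, k \oc u = g.

(* c : Y -> C is a cokernel of f : X -> Y *)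
Definition is_cokernel (X Y : A) (f : mor X Y) (C : A) (c : mor Y C) : Prop :=
  c \oc f = 0 /\
  forall (Z : A) (g : mor Y Z), g \oc f = 0 ->
    exists! u : mor C Z, u \oc c = g.

Definition short_exact (X Y Z : A) (f : mor X Y) (g : mor Y Z) : Prop :=
  is_kernel g f /\ is_cokernel f g.

Definition is_zero (Z : A) : Prop :=
  forall X : A, (exists! f : mor X Z, True) /\ (exists! f : mor Z X, True).

Definition is_biproduct (X Y P : A) (i1 : mor X P) (i2 : mor Y P)
    (p1 : mor P X) (p2 : mor P Y) : Prop :=
  [/\ p1 \oc i1 = idm X, p2 \oc i2 = idm Y, p1 \oc i2 = 0, p2 \oc i1 = 0
    & i1 \oc p1 + i2 \oc p2 = idm P].

Definition is_coproduct (I : small) (F : I -> A) (C : A)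
    (i_ : forall i, mor (F i) C) : Prop :=
  forall (Z : A) (g : forall i, mor (F i) Z),
    exists! u : mor C Z, forall i, u \oc i_ i = g i.

Definition is_generator (U : A) : Prop :=
  forall (X Y : A) (f g : mor X Y),
    (forall h : mor U X, f \oc h = g \oc h) -> f = g.

End Morphisms.

Record is_abelian (A : category) : Prop := IsAbelian {
  has_zero : exists Z : A, is_zero Z;
  has_biproducts : forall X Y : A, exists P : A,
    exists (i1 : mor X P) (i2 : mor Y P) (p1 : mor P X) (p2 : mor P Y),
      is_biproduct i1 i2 p1 p2;
  has_kernels : forall (X Y : A) (f : mor X Y),
    exists (K : A) (k : mor K X), is_kernel f k;
  has_cokernels : forall (X Y : A) (f : mor X Y),
    exists (C : A) (c : mor Y C), is_cokernel f c;
  mono_is_kernel : forall (X Y : A) (f : mor X Y), mono f ->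
    exists (Z : A) (g : mor Y Z), is_kernel g f;
  epi_is_cokernel : forall (X Y : A) (f : mor X Y), epi f ->
    exists (Z : A) (g : mor Z X), is_cokernel g f
}.

Section DirectLimits.
Variables (I : small) (le : I -> I -> Prop).

Definition directed : Prop :=
  [/\ inhabited I,
      forall i, le i i,
      forall i j k, le i j -> le j k -> le i k
    & forall i j, exists k, le i k /\ le j k].

Record dsystem (A : category) := DSystem {
  dobj :> I -> A;
  dmap : forall i j, le i j -> mor (dobj i) (dobj j);
  dmap1 : forall i (ii : le i i), dmap ii = idm (dobj i);
  dmapM : forall i j k (ij : le i j) (jk : le j k) (ik : le i k),
    dmap jk \oc dmap ij = dmap ik
}.

Variable A : category.
Implicit Types D E : dsystem A.

Definition dnatural D E (f : forall i, mor (D i) (E i)) : Prop :=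
  forall i j (ij : le i j), dmap E ij \oc f i = f j \oc dmap D ij.

Definition is_cocone D (L : A) (c : forall i, mor (D i) L) : Prop :=
  forall i j (ij : le i j), c j \oc dmap D ij = c i.

Definition is_direct_limit D (L : A) (c : forall i, mor (D i) L) : Prop :=
  is_cocone c /\
  forall (Z : A) (z : forall i, mor (D i) Z), is_cocone z ->
    exists! u : mor L Z, forall i, u \oc c i = z i.

End DirectLimits.

Definition direct_limits_exact (A : category) : Prop :=
  forall (I : small) (le : I -> I -> Prop), directed le ->
  forall (D E F : dsystem le A)
    (f : forall i, mor (D i) (E i)) (g : forall i, mor (E i) (F i)),
  dnatural f -> dnatural g -> (forall i, short_exact (f i) (g i)) ->
  forall (LD LE LF : A) (cD : forall i, mor (D i) LD)
    (cE : forall i, mor (E i) LE) (cF : forall i, mor (F i) LF),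
  is_direct_limit cD -> is_direct_limit cE -> is_direct_limit cF ->
  forall (u : mor LD LE) (v : mor LE LF),
  (forall i, u \oc cD i = cE i \oc f i) ->
  (forall i, v \oc cE i = cF i \oc g i) ->
  short_exact u v.

(* An abelian category with arbitrary coproducts (hence all colimits), exact
   direct limits and a generator. *)
Record is_grothendieck (A : category) : Prop := IsGrothendieck {
  grothendieck_abelian : is_abelian A;
  has_coproducts : forall (I : small) (F : I -> A),
    exists (C : A) (i_ : forall i, mor (F i) C), is_coproduct i_;
  has_exact_direct_limits : direct_limits_exact A;
  has_generator : exists U : A, is_generator U
}.

(* cs_rickart M N : N is M-CS-Rickart.  The condition does not depend on the
   choice of the kernel k, which exists in any abelian category. *)
Definition cs_rickart (A : category) (M N : A) : Prop :=
  forall f : mor M N,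
  exists (K : A) (k : mor K M), is_kernel f k /\
  exists (L : A) (e : mor K L) (s : mor L M),
    [/\ essential_mono e, is_section s & k = s \oc e].

Record functor (A B : category) := Functor {
  fobj :> A -> B;
  fmap : forall X Y, mor X Y -> mor (fobj X) (fobj Y);
  fmap1 : forall X, fmap (idm X) = idm (fobj X);
  fmapM : forall X Y Z (g : mor Y Z) (f : mor X Y),
    fmap (g \oc f) = fmap g \oc fmap f
}.

(* T is left adjoint to S *)
Record adjunction (A B : category) (T : functor B A) (S : functor A B) :=
  Adjunction {
  adj : forall (Y : B) (X : A), mor (T Y) X -> mor Y (S X);
  adj_bij : forall Y X, bijective (@adj Y X);
  adj_natural : forall (Y Y' : B) (X X' : A)
      (g : mor Y' Y) (f : mor X X') (h : mor (T Y) X),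
    adj (f \oc h \oc fmap T g) = fmap S f \oc adj h \oc g
}.

(* Right R-modules are left modules over the converse ring R^c: with
   x . r := (r : R^c) *: x one gets x . (r * s) = (x . r) . s. *)
Section RightModules.
Variable R : pzRingType.

Definition modhom (M N : lmodType R^c) : Type := {linear M -> N}.

Section ModHom.
Variables M N : lmodType R^c.
Implicit Types f g h : modhom M N.

HB.instance Definition _ := gen_eqMixin (modhom M N).
HB.instance Definition _ := gen_choiceMixin (modhom M N).

Lemma modhomP f g : (f : M -> N) =1 g -> f = g.
Proof.
case: f g => [f [[fa] [fl]]] [g [[ga] [gl]]] /= /funext fg.
rewrite -{}fg in ga gl *.
by rewrite (Prop_irrelevance fa ga) (Prop_irrelevance fl gl).
Qed.

Definition modhom0 : modhom M N := \0 : {linear M -> N}.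
Definition modhomN f : modhom M N :=
  (\- (f : {linear M -> N})) : {linear M -> N}.
Definition modhomD f g : modhom M N :=
  ((f : {linear M -> N}) \+ (g : {linear M -> N})) : {linear M -> N}.

Fact modhom_addrA : associative modhomD.
Proof. by move=> f g h; apply: modhomP => x /=; rewrite addrA. Qed.
Fact modhom_addrC : commutative modhomD.
Proof. by move=> f g; apply: modhomP => x /=; rewrite addrC. Qed.
Fact modhom_add0r : left_id modhom0 modhomD.
Proof. by move=> f; apply: modhomP => x /=; rewrite add0r. Qed.
Fact modhom_addNr : left_inverse modhom0 modhomN modhomD.
Proof. by move=> f; apply: modhomP => x /=; rewrite addNr. Qed.

HB.instance Definition _ := GRing.isZmodule.Build (modhom M N)
  modhom_addrA modhom_addrC modhom_add0r modhom_addNr.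
End ModHom.

Definition modid (M : lmodType R^c) : modhom M M := idfun : {linear M -> M}.
Definition modcomp (M N P : lmodType R^c) (g : modhom N P) (f : modhom M N) :
  modhom M P :=
  ((g : {linear N -> P}) \o (f : {linear M -> N})) : {linear M -> P}.

Fact modcompA (M N P Q : lmodType R^c)
    (h : modhom P Q) (g : modhom N P) (f : modhom M N) :
  modcomp h (modcomp g f) = modcomp (modcomp h g) f.
Proof. exact: modhomP. Qed.
Fact modcomp1m (M N : lmodType R^c) (f : modhom M N) : modcomp (modid N) f = f.
Proof. exact: modhomP. Qed.
Fact modcompm1 (M N : lmodType R^c) (f : modhom M N) : modcomp f (modid M) = f.
Proof. exact: modhomP. Qed.
Fact modcompDl (M N P : lmodType R^c) (g g' : modhom N P) (f : modhom M N) :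
  modcomp (g + g') f = modcomp g f + modcomp g' f.
Proof. exact: modhomP. Qed.
Fact modcompDr (M N P : lmodType R^c) (g : modhom N P) (f f' : modhom M N) :
  modcomp g (f + f') = modcomp g f + modcomp g f'.
Proof. by apply: modhomP => x /=; rewrite linearD. Qed.

Definition Mod : category :=
  @Category (lmodType R^c) modhom modid modcomp
    modcompA modcomp1m modcompm1 modcompDl modcompDr.

End RightModules.

Section HomFunctor.
Variables (A : category) (U : A).

(* The ring End(U), with multiplication r * s = r o s; it is a pzRingType
   because it is trivial when U = 0. *)
Definition EndRing : Type := mor U U.
HB.instance Definition _ := GRing.Zmodule.on EndRing.
HB.instance Definition _ := GRing.Zmodule_isPzRing.Build EndRing
  (@mcompA A U U U U) (@mcomp1m A U U) (@mcompm1 A U U)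
  (fun r s t => @mcompDl A U U U r s t) (@mcompDr A U U U).

(* Hom(U, X) is a right End(U)-module under precomposition. *)
Definition homU (X : A) : Type := mor U X.
HB.instance Definition _ (X : A) := GRing.Zmodule.on (homU X).

Section HomUModule.
Variable X : A.
Definition homU_act (r : EndRing^c) (x : homU X) : homU X := mcomp x r.

Fact homU_scalerA r s x : homU_act r (homU_act s x) = homU_act (r * s) x.
Proof. by rewrite /homU_act -mcompA. Qed.
Fact homU_scale1r : left_id 1 homU_act.
Proof. by move=> x; apply: mcompm1. Qed.
Fact homU_scalerDr : right_distributive homU_act +%R.
Proof. by move=> r x y; apply: mcompDl. Qed.
Fact homU_scalerDl x : {morph homU_act^~ x : r s / r + s}.
Proof. by move=> r s; apply: mcompDr. Qed.

HB.instance Definition _ := GRing.Zmodule_isLmodule.Build EndRing^c (homU X)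
  homU_scalerA homU_scale1r homU_scalerDr homU_scalerDl.
End HomUModule.

Definition postcomp (X Y : A) (f : mor X Y) (x : homU X) : homU Y := f \oc x.

Fact postcomp_linear (X Y : A) (f : mor X Y) : linear (postcomp f).
Proof. by move=> r x y; rewrite /postcomp mcompDr mcompA. Qed.
HB.instance Definition _ (X Y : A) (f : mor X Y) :=
  GRing.isLinear.Build EndRing^c (homU X) (homU Y) _ (postcomp f)
    (postcomp_linear f).

Definition hom_map (X Y : A) (f : mor X Y) : modhom (homU X) (homU Y) :=
  postcomp f : {linear homU X -> homU Y}.

Fact hom_map1 (X : A) : hom_map (idm X) = modid (homU X).
Proof. by apply: modhomP => x; apply: mcomp1m. Qed.
Fact hom_mapM (X Y Z : A) (g : mor Y Z) (f : mor X Y) :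
  hom_map (g \oc f) = modcomp (hom_map g) (hom_map f).
Proof. by apply: modhomP => x; rewrite /= /postcomp mcompA. Qed.

Definition HomFunctor : functor A (Mod EndRing) :=
  @Functor A (Mod EndRing) (fun X => homU X : lmodType EndRing^c)
    hom_map hom_map1 hom_mapM.

End HomFunctor.

(* Main.v *)
Require Import Defs.
From mathcomp Require Import all_boot all_order all_algebra.
From HB Require Import structures.
From mathcomp Require Import boolp.

(** Only the full faithfulness of [S = Hom(U, -)] is needed, not the exactness
    of its left adjoint.  Faithfulness is the generator property.  For
    fullness, call a subobject [D] of [M] good for a linear map
    [phi : S M -> S N] if [phi] is induced on [S D] by a morphism [D -> N].
    Good subobjects are closed under finite sums and contain the image of
    every [U -> M], so by exactness of direct limits their directed union is
    [M], and the (unique) morphisms [D -> N] glue to a morphism [M -> N]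
    inducing [phi].

    [S] preserves and reflects kernels, sections and essential monomorphisms.
    That it preserves essential monomorphisms [K -> L] is seen on cyclic
    submodules: if [x : U -> L] is such that [x r] in [K] implies [x r = 0],
    then the image of [x] meets [K] trivially, so [x = 0].  The converse
    implication of the theorem also uses that idempotents split in [A], so
    that every direct summand of [S M] is, up to isomorphism, the image under
    [S] of a direct summand of [M]. *)

Set Implicit Arguments.
Unset Strict Implicit.
Unset Printing Implicit Defensive.

Import GRing.Theory.
Local Open Scope ring_scope.

Lemma dep_choice (I : Type) (T : I -> Type) (P : forall i, T i -> Prop) :
  (forall i, exists x, P i x) -> exists f, forall i, P i (f i).
Proof. by move=> h; exists (fun i => projT1 (cid (h i))) => i; case: cid. Qed.

(** * Zero morphisms, monomorphisms and kernels in preadditive categories *)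

Section Preadditive.
Variable A : category.
Implicit Types X Y Z : A.

Lemma mcompm0 X Y Z (f : mor Y Z) : f \oc (0 : mor X Y) = 0.
Proof. by apply: (addrI (f \oc 0)); rewrite -mcompDr !addr0. Qed.

Lemma mcomp0m X Y Z (f : mor X Y) : (0 : mor Y Z) \oc f = 0.
Proof. by apply: (addrI (0 \oc f)); rewrite -mcompDl !addr0. Qed.

Lemma mcompmN X Y Z (f : mor Y Z) (g : mor X Y) : f \oc (- g) = - (f \oc g).
Proof. by apply: (addrI (f \oc g)); rewrite -mcompDr !subrr mcompm0. Qed.

Lemma mcompNm X Y Z (f : mor Y Z) (g : mor X Y) : (- f) \oc g = - (f \oc g).
Proof. by apply: (addrI (f \oc g)); rewrite -mcompDl !subrr mcomp0m. Qed.

Lemma mcompBr X Y Z (f : mor Y Z) (g h : mor X Y) :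
  f \oc (g - h) = f \oc g - f \oc h.
Proof. by rewrite mcompDr mcompmN. Qed.

Lemma mcompBl X Y Z (f g : mor Y Z) (h : mor X Y) :
  (f - g) \oc h = f \oc h - g \oc h.
Proof. by rewrite mcompDl mcompNm. Qed.

Lemma mono0P X Y (f : mor X Y) :
  mono f <-> forall Z (u : mor Z X), f \oc u = 0 -> u = 0.
Proof.
split=> [fm Z u fu0|f0 Z u v fuv]; first by apply: fm; rewrite mcompm0.
by apply/eqP; rewrite -subr_eq0; apply/eqP/f0; rewrite mcompBr fuv subrr.
Qed.

Lemma epi0P X Y (f : mor X Y) :
  epi f <-> forall Z (u : mor Y Z), u \oc f = 0 -> u = 0.
Proof.
split=> [fe Z u fu0|f0 Z u v fuv]; first by apply: fe; rewrite mcomp0m.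
by apply/eqP; rewrite -subr_eq0; apply/eqP/f0; rewrite mcompBl fuv subrr.
Qed.

Lemma mono_comp X Y Z (g : mor Y Z) (f : mor X Y) :
  mono g -> mono f -> mono (g \oc f).
Proof. by move=> gm fm W u v; rewrite -!mcompA => /gm/fm. Qed.

Lemma mono_cancel X Y Z (g : mor Y Z) (f : mor X Y) : mono (g \oc f) -> mono f.
Proof. by move=> gfm W u v fuv; apply: gfm; rewrite -!mcompA fuv. Qed.

Lemma idm_mono X : mono (idm X).
Proof. by move=> W u v; rewrite !mcomp1m. Qed.

Lemma kernel_mono X Y (f : mor X Y) K (k : mor K X) : is_kernel f k -> mono k.
Proof.
move=> [fk0 kP] Z u v kuv.
have [|w [_ wU]] := kP _ (k \oc v); first by rewrite mcompA fk0 mcomp0m.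
by rewrite -(wU u) // -(wU v).
Qed.

Lemma cokernel_epi X Y (f : mor X Y) C (c : mor Y C) : is_cokernel f c -> epi c.
Proof.
move=> [cf0 cP] Z u v cuv.
have [|w [_ wU]] := cP _ (v \oc c); first by rewrite -mcompA cf0 mcompm0.
by rewrite -(wU u) // -(wU v).
Qed.

Lemma kernel_lift X Y (f : mor X Y) K (k : mor K X) Z (g : mor Z X) :
  is_kernel f k -> f \oc g = 0 -> exists u, k \oc u = g.
Proof. by move=> [_ kP] /kP [u [ku _]]; exists u. Qed.

Lemma cokernel_desc X Y (f : mor X Y) C (c : mor Y C) Z (g : mor Y Z) :
  is_cokernel f c -> g \oc f = 0 -> exists u, u \oc c = g.
Proof. by move=> [_ cP] /cP [u [uc _]]; exists u. Qed.

Lemma is_zero_from0 Z X (f : mor Z X) : is_zero Z -> f = 0.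
Proof. by move=> /(_ X) [_ [u [_ uU]]]; rewrite -(uU f) // -(uU 0). Qed.

End Preadditive.

(** * Images, generators and idempotents in abelian categories *)

Section Abelian.
Variable A : category.
Hypothesis abA : is_abelian A.
Implicit Types X Y Z : A.

Lemma epi_desc X Y Z (q : mor X Y) (z : mor X Z) : epi q ->
  (forall W (a : mor W X), q \oc a = 0 -> z \oc a = 0) ->
  exists t, t \oc q = z.
Proof.
move=> /(epi_is_cokernel abA) [W [a aq]] za.
by apply: (cokernel_desc aq); apply: za; case: aq.
Qed.

(** If [z \oc q = 0] and [n] is a kernel of [z], then [f] factors through [m \oc n]. This is a
    kernel of some [b], which kills [f], hence factors through [c] and kills [m]; so [n] has a right
    inverse and [z = 0]. *)
Lemma image_epi X Y (f : mor X Y) C (c : mor Y C) D (m : mor D Y)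
    (q : mor X D) :
  is_cokernel f c -> is_kernel c m -> m \oc q = f -> epi q.
Proof.
move=> fc cm mq; apply/epi0P => Z z zq0.
have [E [n zn]] := has_kernels abA z.
have [q' nq'] := kernel_lift zn zq0.
have mm := kernel_mono cm.
have [W [b bmn]] := mono_is_kernel abA (mono_comp mm (kernel_mono zn)).
have [b' b'c] : exists b', b' \oc c = b.
  apply: (cokernel_desc fc); rewrite -mq -nq' !mcompA -(mcompA b).
  by case: bmn => -> _; rewrite mcomp0m.
have [w mnw] : exists w, m \oc n \oc w = m.
  by apply: (kernel_lift bmn); rewrite -b'c -mcompA (proj1 cm) mcompm0.
have nw : n \oc w = idm D by apply: mm; rewrite mcompA mnw mcompm1.
by rewrite -(mcompm1 z) -nw mcompA (proj1 zn) mcomp0m.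
Qed.

(** A substitute for element chasing: a generalized element of the image of [f] lifts to [X] after
    passing to a cover [v1]. *)
Lemma cokernel_cover X Y (f : mor X Y) C (c : mor Y C) W (y : mor W Y) :
  is_cokernel f c -> c \oc y = 0 ->
  exists (V : A) (v1 : mor V W) (v2 : mor V X),
    epi v1 /\ y \oc v1 = f \oc v2.
Proof.
move=> fc cy0; have [D [m cm]] := has_kernels abA c.
have [y' my'] := kernel_lift cm cy0.
have [q mq] := kernel_lift cm (proj1 fc).
have qe := image_epi fc cm mq.
have [P [i1 [i2 [p1 [p2 [p11 p22 p12 p21 _]]]]]] := has_biproducts abA W X.
(* The kernel of [d] is the pullback of [y'] and [q]. *)
pose d := y' \oc p1 - q \oc p2.
have di2 : d \oc i2 = - q.
  by rewrite mcompBl -!mcompA p12 p22 mcompm0 mcompm1 sub0r.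
have de : epi d.
  apply/epi0P => Z u ud0; have := congr1 (fun g => g \oc i2) ud0.
  rewrite mcomp0m -mcompA di2 mcompmN => /eqP; rewrite oppr_eq0 => /eqP.
  by move/epi0P: qe; apply.
have [V [v dv]] := has_kernels abA d.
exists V, (p1 \oc v), (p2 \oc v); split; last first.
  apply/eqP; rewrite -subr_eq0 -my' -mq -!mcompA -mcompBr !mcompA -mcompBl.
  by rewrite (proj1 dv) mcompm0.
apply/epi0P => Z z; rewrite mcompA => zv0.
(* The pullback of the epimorphism [q] is epi: [z \oc p1] descends along [d] to some [t], and
   restriction along [i2] gives [t \oc q = 0]. *)
have [t td] : exists t, t \oc d = z \oc p1.
  apply: epi_desc de _ => E a /(kernel_lift dv) [a' <-].
  by rewrite mcompA zv0 mcomp0m.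
have t0 : t = 0.
  move/epi0P: qe; apply; apply/eqP.
  by rewrite -oppr_eq0 -mcompmN -di2 mcompA td -mcompA p12 mcompm0.
by rewrite -(mcompm1 z) -p11 mcompA -td t0 !mcomp0m.
Qed.

Lemma generator0 (U : A) X Y (f : mor X Y) : is_generator U ->
  (forall h : mor U X, f \oc h = 0) -> f = 0.
Proof. by move=> hU f0; apply: hU => h; rewrite f0 mcomp0m. Qed.

Lemma mono_factor (U : A) D Y X (m : mor D Y) (f : mor X Y) :
  is_generator U -> mono m ->
  (forall r : mor U X, exists r', m \oc r' = f \oc r) ->
  exists u, m \oc u = f.
Proof.
move=> hU /(mono_is_kernel abA) [Z [g gm]] fr; apply: (kernel_lift gm).
apply: (generator0 hU) => r; have [r' mr'] := fr r.
by rewrite -mcompA -mr' mcompA (proj1 gm) mcomp0m.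
Qed.

(** For a cokernel [c] of [x], the hypothesis on [x] makes [c \oc e] monic; essentiality then makes
    [c] monic, while [c \oc x = 0]. *)
Lemma essential_generator (U : A) K L (e : mor K L) (x : mor U L) :
  is_generator U -> essential_mono e ->
  (forall (r : mor U U) (y : mor U K), x \oc r = e \oc y -> x \oc r = 0) ->
  x = 0.
Proof.
move=> hU [em ess] xr0.
have [C [c xc]] := has_cokernels abA x.
have cem : mono (c \oc e).
  apply/mono0P => Z z cez0; apply: (generator0 hU) => h; apply: em.
  rewrite mcompm0.
  have [|V [v1 [v2 [v1e ezv]]]] :=
      cokernel_cover (y := e \oc (z \oc h)) xc.
    by rewrite !mcompA cez0 mcomp0m.
  move/epi0P: v1e; apply; apply: (generator0 hU) => r.
  rewrite ezv -mcompA; apply: (xr0 _ (z \oc h \oc v1 \oc r)).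
  by rewrite mcompA -ezv !mcompA.
by have /mono0P := ess _ _ cem; apply; case: xc.
Qed.

(** The image of [p] is obtained as the kernel of [idm X - p]. *)
Lemma idempotent_split X (p : mor X X) : p \oc p = p ->
  exists (L : A) (s : mor L X) (t : mor X L), t \oc s = idm L /\ s \oc t = p.
Proof.
move=> pp; have [L [s ps]] := has_kernels abA (idm X - p).
have [|t st] := kernel_lift (g := p) ps.
  by rewrite mcompBl mcomp1m pp subrr.
exists L, s, t; split=> //; apply: (kernel_mono ps).
rewrite mcompA st mcompm1; apply/esym/eqP; rewrite -subr_eq0.
by case: ps; rewrite mcompBl mcomp1m => ->.
Qed.

End Abelian.

(** * Direct limits and directed unions in a Grothendieck category *)

Section DirectLimitExistence.
Variable A : category.
Hypothesis hA : is_grothendieck A.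

(** The limit is the cokernel of the difference map [d] from the coproduct over all pairs [i <= j]
    to the coproduct of the [D i]. *)
Lemma direct_limit_exists (I : small) (le : I -> I -> Prop) (D : dsystem le A) :
  exists (L : A) (c : forall i, mor (D i) L), is_direct_limit c.
Proof.
pose J : small := {ij : I * I | le ij.1 ij.2}.
have [C [i_ iP]] := has_coproducts hA (fun i => D i).
have [R [j_ jP]] := has_coproducts hA (fun x : J => D (sval x).1).
have [d [dP _]] :=
  jP C (fun x => i_ (sval x).2 \oc dmap D (proj2_sig x) - i_ (sval x).1).
have [L [q qP]] := has_cokernels (grothendieck_abelian hA) d.
exists L, (fun i => q \oc i_ i); split=> [i j ij|Z z zc].
  apply/eqP; rewrite -subr_eq0 -mcompA -mcompBr.
  have <- : d \oc j_ (exist _ (i, j) ij) = i_ j \oc dmap D ij - i_ i := dP _.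
  by rewrite mcompA (proj1 qP) mcomp0m.
have [u [uP uU]] := iP Z z.
have [w wq] : exists w, w \oc q = u.
  apply: (cokernel_desc qP).
  have [v [_ vU]] := jP Z (fun=> 0).
  have <- : v = u \oc d.
    apply: vU => x; rewrite -mcompA dP mcompBr mcompA !uP.
    by apply/eqP; rewrite subr_eq0; apply/eqP/zc.
  by apply: vU => x; apply: mcomp0m.
exists w; split=> [i|w' w'P]; first by rewrite mcompA wq.
apply: (cokernel_epi qP); rewrite wq; apply: uU => i.
by rewrite -mcompA.
Qed.

(* By exactness of direct limits, [M] is the direct limit of the [D i]: the
   quotients [M / D i] have direct limit [0]. *)
Lemma directed_union_glue (U : A) (hU : is_generator U) (I : small)
    (le : I -> I -> Prop) (M N : A) (D : I -> A)
    (m : forall i, mor (D i) M) (g : forall i, mor (D i) N) :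
  directed le -> (forall i, mono (m i)) ->
  (forall i j, le i j -> exists u, m j \oc u = m i) ->
  (forall i j u, m j \oc u = m i -> g j \oc u = g i) ->
  (forall x : mor U M, exists i y, m i \oc y = x) ->
  exists G, forall i, G \oc m i = g i.
Proof.
move=> dle mm mle gle mU; have abA := grothendieck_abelian hA.
have [[i0] lexx letr leub] := dle.
pose dm i j (ij : le i j) := projT1 (cid (mle i j ij)).
have dmE i j (ij : le i j) : m j \oc dm i j ij = m i by rewrite /dm; case: cid.
have dm1 i (ii : le i i) : dm i i ii = idm (D i).
  by apply: mm; rewrite dmE mcompm1.
have dmM i j k (ij : le i j) (jk : le j k) (ik : le i k) :
    dm j k jk \oc dm i j ij = dm i k ik.
  by apply: mm; rewrite mcompA !dmE.
pose DD := DSystem dm1 dmM.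
have /dep_choice [Q /dep_choice [c cP]] i := has_cokernels abA (m i).
have ce i := cokernel_epi (cP i).
have qle i j (ij : le i j) : exists u, u \oc c i = c j.
  apply: (cokernel_desc (cP i)).
  by rewrite -(dmE i j ij) mcompA (proj1 (cP j)) mcomp0m.
pose qm i j (ij : le i j) := projT1 (cid (qle i j ij)).
have qmE i j (ij : le i j) : qm i j ij \oc c i = c j by rewrite /qm; case: cid.
have qm1 i (ii : le i i) : qm i i ii = idm (Q i).
  by apply: ce; rewrite qmE mcomp1m.
have qmM i j k (ij : le i j) (jk : le j k) (ik : le i k) :
    qm j k jk \oc qm i j ij = qm i k ik.
  by apply: ce; rewrite -mcompA !qmE.
pose QQ := DSystem qm1 qmM.
pose MM := @DSystem I le A (fun=> M) (fun _ _ _ => idm M) (fun _ _ => erefl)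
  (fun _ _ _ _ _ _ => mcomp1m (idm M)).
have Mconst Z (z : I -> mor M Z) : (forall i j, le i j -> z j = z i) ->
    forall i j, z i = z j.
  move=> zle i j; have [k [ik jk]] := leub i j.
  by rewrite -(zle _ _ ik) (zle _ _ jk).
have [O zO] := has_zero abA.
have [LD [cD cDP]] := direct_limit_exists DD.
have cMP : is_direct_limit (D := MM) (fun=> idm M).
  split=> [i j ij|Z z zc]; first by rewrite mcomp1m.
  exists (z i0); split=> [i|u /(_ i0)]; last by rewrite mcompm1.
  rewrite mcompm1; apply: Mconst => j k jk.
  by rewrite -(zc j k jk) mcompm1.
(* For a cocone [z], the composite [z i \oc c i] does not depend on [i]; every [U -> M] factors
   through some [m j], which [c j] kills. *)
have cQP : is_direct_limit (D := QQ) (fun i => 0 : mor (Q i) O).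
  split=> [i j ij|Z z zc]; first exact: mcomp0m.
  exists 0; split=> [i|u _]; last by rewrite (is_zero_from0 u zO).
  rewrite mcomp0m; apply/esym; apply: ce; rewrite mcomp0m.
  apply: (generator0 hU) => x; have [j [y <-]] := mU x.
  have -> : z i \oc c i = z j \oc c j.
    apply: (Mconst _ (fun i => z i \oc c i)) => k l kl.
    by rewrite -(zc k l kl) /= -mcompA qmE.
  by rewrite mcompA -(mcompA (z j)) (proj1 (cP j)) mcompm0 mcomp0m.
have [uc _] := cDP; have [|u [uE _]] := (proj2 cDP) M m.
  by move=> i j ij; apply: dmE.
have [|G [GE _]] := (proj2 cDP) N g.
  by move=> i j ij; apply: gle; apply: dmE.
(* In the limit, [u : LD -> M] becomes a kernel of a zero morphism, hence invertible. *)
have [ku _] : short_exact u (0 : mor M O).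
  apply: (@has_exact_direct_limits A hA I le dle DD MM QQ m c _ _ _ LD M O
    cD (fun=> idm M) (fun=> 0)) => //.
  - by move=> i j ij /=; rewrite mcomp1m dmE.
  - by move=> i j ij /=; rewrite mcompm1 qmE.
  - move=> i; split=> //; split=> [|Z h ch0]; first by case: (cP i).
    (* [m i] is a kernel of some [b]; since [b] factors through [c i], it is a kernel of [c i]
       too. *)
    have [W [b bm]] := mono_is_kernel abA (mm i).
    apply: (proj2 bm).
    have [b' <-] := cokernel_desc (cP i) (proj1 bm).
    by rewrite -mcompA ch0 mcompm0.
  - by move=> i; rewrite uE mcomp1m.
  - by move=> i; rewrite !mcomp0m.
have [w uw] := kernel_lift (g := idm M) ku (mcomp0m _ _).
have wu : w \oc u = idm LD.
  by apply: (kernel_mono ku); rewrite mcompA uw mcomp1m mcompm1.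
exists (G \oc w) => i.
by rewrite -(uE i) -mcompA (mcompA w) wu mcomp1m.
Qed.

End DirectLimitExistence.

Lemma modhom_eq_app (R : pzRingType) (X Y : lmodType R^c) (f g : modhom X Y) :
  f = g -> (f : X -> Y) =1 g.
Proof. by move=> ->. Qed.

(** * Full faithfulness of [Hom(U, -)] *)

Section HomFull.
Variables (A : category) (U : A).
Hypotheses (hA : is_grothendieck A) (hU : is_generator U).
Let abA := grothendieck_abelian hA.

Lemma hom_map_inj (X Y : A) : injective (@hom_map A U X Y).
Proof.
move=> f g fg; apply: hU => h.
exact: (modhom_eq_app fg h).
Qed.

Section Full.
Variables (M N : A) (phi : modhom (homU U M) (homU U N)).

Definition induces (D : A) (p : mor D M) (g : mor D N) : Prop :=
  forall r : mor U D, g \oc r = phi (p \oc r : homU U M).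

Lemma phi_comp (x : mor U M) (r : mor U U) :
  phi (x \oc r : homU U M) = (phi x : mor U N) \oc r.
Proof. exact: (linearZ_LR (phi : {linear _ -> _}) (r : (EndRing U)^c) x). Qed.

(** Allows [p] to be replaced by its image: [f] vanishes wherever [p] does, so it descends to the
    image. *)
Lemma induces_image (C : A) (p : mor C M) (f : mor C N) : induces p f ->
  exists (D : A) (m : mor D M) (g : mor D N) (q : mor C D),
    [/\ mono m, induces m g & m \oc q = p].
Proof.
move=> pf; have [Z [c pc]] := has_cokernels abA p.
have [D [m cm]] := has_kernels abA c.
have mm := kernel_mono cm.
have [q mq] := kernel_lift cm (proj1 pc).
have [g gq] : exists g, g \oc q = f.
  apply: (epi_desc abA (image_epi abA pc cm mq)) => W a qa0.
  apply: (generator0 hU) => r; rewrite -mcompA pf -mq -mcompA (mcompA q) qa0.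
  by rewrite mcomp0m mcompm0 (raddf0 (phi : {linear _ -> _})).
exists D, m, g, q; split=> // y.
(* [U] need not be projective, so [y] lifts to [C] only along a cover [v1]; precomposing with
   [r : U -> V] gives an endomorphism [v1 \oc r] of [U], with which [phi] commutes. *)
have [|V [v1 [v2 [v1e myv]]]] := cokernel_cover abA (y := m \oc y) pc.
  by rewrite mcompA (proj1 cm) mcomp0m.
apply: v1e; apply: hU => r; rewrite -[RHS]mcompA -phi_comp (mcompA (m \oc y)).
rewrite myv -(mcompA p) -pf -gq -!mcompA (mcompA q) (mcompA y).
congr (g \oc _); congr (_ \oc r).
by apply: mm; rewrite !mcompA myv mq.
Qed.

(** The sum of two subobjects is the image of their biproduct, on which additivity of [phi]
    applies. *)
Lemma induces_add (D1 D2 : A) (m1 : mor D1 M) (m2 : mor D2 M) g1 g2 :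
  induces m1 g1 -> induces m2 g2 ->
  exists (D : A) (m : mor D M) (g : mor D N) q1 q2,
    [/\ mono m, induces m g, m \oc q1 = m1 & m \oc q2 = m2].
Proof.
move=> mg1 mg2.
have [P [i1 [i2 [p1 [p2 [p11 p22 p12 p21 _]]]]]] := has_biproducts abA D1 D2.
have [|D [m [g [q [mm mg mq]]]]] :=
    @induces_image P (m1 \oc p1 + m2 \oc p2) (g1 \oc p1 + g2 \oc p2).
  move=> r; rewrite !mcompDl (raddfD (phi : {linear _ -> _})) -!mcompA.
  by rewrite mg1 mg2.
exists D, m, g, (q \oc i1), (q \oc i2).
by split=> //; rewrite mcompA mq mcompDl -!mcompA ?p11 ?p12 ?p21 ?p22
  !(mcompm0, mcompm1) ?addr0 ?add0r.
Qed.

Definition represents (P : mor U M -> Prop) (D : A) (m : mor D M)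
    (g : mor D N) : Prop :=
  [/\ mono m, induces m g & forall x, P x <-> exists y, m \oc y = x].

(* A subobject of [M] is encoded by the set of morphisms [U -> M] factoring
   through it, so that the good subobjects are indexed by a small type. *)
Definition good_subobject : small :=
  {P : mor U M -> Prop | exists (D : A) (m : mor D M) g, represents P m g}.

Lemma good_subobject_intro (D : A) (m : mor D M) g : mono m -> induces m g ->
  exists P : good_subobject, sval P = fun x => exists y, m \oc y = x.
Proof.
move=> mm mg; have h : exists (D : A) (m' : mor D M) g',
    represents (fun x => exists y, m \oc y = x) m' g'.
  by exists D, m, g; split.
by exists (exist _ (fun x => exists y, m \oc y = x) h).
Qed.

Theorem hom_map_full : exists f : mor M N, hom_map U f = phi.
Proof.
have /dep_choice [D /dep_choice [m /dep_choice [g DP]]] (P : good_subobject) :=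
  svalP P.
pose le (P Q : good_subobject) := forall x, sval P x -> sval Q x.
have mU (x : mor U M) : exists i y, m i \oc y = x.
  (* By linearity, [phi x : U -> N] induces [phi] along [x], so the image of [x] is good. *)
  have [|E [n [h [q [nm nh nq]]]]] := @induces_image U x (phi x).
    by move=> r; rewrite phi_comp.
  have [P PE] := good_subobject_intro nm nh.
  by exists P; have [_ _ /(_ x) <-] := DP P; rewrite PE; exists q.
have dle : directed le.
  split=> [|i x //|i j k ij jk x /ij/jk //|i j].
    by have [i _] := mU 0; constructor.
  have [_ mi Pi] := DP i; have [_ mj Pj] := DP j.
  have [E [n [h [q1 [q2 [nm nh nq1 nq2]]]]]] := induces_add mi mj.
  have [P PE] := good_subobject_intro nm nh.
  exists P; rewrite /le PE; split=> x.
    by move/Pi => [y <-]; exists (q1 \oc y); rewrite mcompA nq1.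
  by move/Pj => [y <-]; exists (q2 \oc y); rewrite mcompA nq2.
have [|||G GE] := directed_union_glue hA hU (g := g) dle _ _ _ mU.
- by move=> i; case: (DP i).
- move=> i j ij; have [mmj _ Pj] := DP j; have [_ _ Pi] := DP i.
  apply: (mono_factor abA hU mmj) => r.
  by apply/Pj/ij/Pi; exists r.
- move=> i j u mu; apply: hU => r; have [_ gi _] := DP i; have [_ gj _] := DP j.
  by rewrite -mcompA gi gj mcompA mu.
exists G; apply: modhomP => x; rewrite /= /postcomp.
have [i [y <-]] := mU x; have [_ gi _] := DP i.
by rewrite mcompA GE gi.
Qed.

End Full.
End HomFull.

(** * Kernels and essential monomorphisms under [Hom(U, -)] *)

Section HomPreservation.
Variables (A : category) (U : A).
Local Notation S := (HomFunctor U).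

Lemma mod_eval0 (R : pzRingType) (X Y : lmodType R^c) (f : modhom X Y) :
  (forall x, f x = 0) -> f = 0.
Proof. by move=> f0; apply: modhomP => x; rewrite f0. Qed.

Lemma hom_map_mono (X Y : A) (f : mor X Y) :
  mono f -> mono (fmap S f : mor (S X) (S Y)).
Proof.
move=> fm; move=> Z u v fuv; apply: modhomP => z; apply: fm.
exact: (modhom_eq_app fuv z).
Qed.

Lemma hom_map_mono_inv (X Y : A) (f : mor X Y) : is_generator U ->
  mono (fmap S f : mor (S X) (S Y)) -> mono f.
Proof.
move=> hU Sfm Z u v fuv; apply: (hom_map_inj hU); apply: (Sfm (S Z)).
by rewrite -!(fmapM S) fuv.
Qed.

(** Lifts through [k] are chosen pointwise; as [k] is monic, they form a linear map. *)
Lemma hom_map_kernel (X Y : A) (f : mor X Y) (K : A) (k : mor K X) :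
  is_kernel f k -> is_kernel (fmap S f) (fmap S k).
Proof.
move=> fk; have km := kernel_mono fk; split.
  by rewrite -fmapM (proj1 fk); apply: mod_eval0 => x; apply: mcomp0m.
move=> Z g fg0.
have /dep_choice [u uP] (z : Z) :
    exists u : homU U K, k \oc u = (g : modhom _ _) z.
  by apply: (kernel_lift fk); exact: (modhom_eq_app fg0 z).
have ul : linear u.
  move=> r x y; apply: km; rewrite uP mcompDr mcompA !uP.
  by rewrite (linearP (g : {linear _ -> _})).
pose ulin := GRing.isLinear.Build (EndRing U)^c Z (homU U K) _ u ul.
pose u' : {linear Z -> homU U K} := HB.pack u ulin.
exists (u' : mor (Z : Mod (EndRing U)) (S K)).
split; first by apply: modhomP => z; apply: uP.
by move=> v kv; apply: modhomP => z; apply: km; rewrite uP -kv.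
Qed.

Lemma hom_map_essential (X Y : A) (e : mor X Y) :
  is_abelian A -> is_generator U ->
  essential_mono e -> essential_mono (fmap S e).
Proof.
move=> abA hU ess; split; first by apply: hom_map_mono; case: ess.
move=> P h hem; apply/mono0P => Z w hw0.
apply: mod_eval0 => z; apply: (essential_generator abA hU ess) => r y xy.
(* [S e] carries the map [S U -> S X] given by [y] into the image of [w], which [h] kills; monicity
   of [h \oc S e] thus makes it zero, and it is evaluated at [idm U]. *)
suff y0 : hom_map U y = 0.
  have := modhom_eq_app y0 (idm U).
  by rewrite /= /postcomp mcompm1 xy => ->; apply: mcompm0.
move/mono0P: hem; apply; apply: mod_eval0 => t /=.
have -> : postcomp e (postcomp y t) =
    (w : modhom _ _) ((t : (EndRing U)^c) *: ((r : (EndRing U)^c) *: z)).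
  by rewrite !(linearZ_LR (w : {linear _ -> _})) /postcomp mcompA -xy.
exact: (modhom_eq_app hw0 _).
Qed.

End HomPreservation.

(** * Transfer of the CS-Rickart condition along [Hom(U, -)] *)

Theorem corollary4p2 (A : category) (hA : is_grothendieck A)
    (U : A) (hU : is_generator U)
    (T : functor (Mod (EndRing U)) A) (TS : adjunction T (HomFunctor U))
    (M N : A) :
  cs_rickart M N <-> cs_rickart (HomFunctor U M) (HomFunctor U N).
Proof.
have abA := grothendieck_abelian hA; set S := HomFunctor U.
split=> [MN phi|SMN f].
  have [f <-] := hom_map_full hA hU phi.
  have [K [k [fk [L [e [s [ess [s' s's] kse]]]]]]] := MN f.
  exists (S K), (fmap S k); split; first exact: hom_map_kernel.
  exists (S L), (fmap S e), (fmap S s); split.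
  - exact: hom_map_essential.
  - by exists (fmap S s'); rewrite -fmapM s's fmap1.
  - by rewrite kse fmapM.
have [K' [k' [fk' [L' [e' [s' [[e'm ess'] [t' t's'] kse']]]]]]] :=
  SMN (fmap S f).
have [K [k fk]] := has_kernels abA f.
have Sfk := hom_map_kernel U fk.
(* The projection of [S M] onto the summand [L'] comes from an endomorphism [p] of [M], idempotent
   by faithfulness; splitting it gives the summand [L]. *)
have [p pE] := hom_map_full hA hU (s' \oc t' : mor (S M) (S M)).
have {}pE : fmap S p = s' \oc t' by [].
have pp : p \oc p = p.
  apply: (hom_map_inj hU); rewrite -[LHS]/(fmap S _) -[RHS]/(fmap S _).
  by rewrite fmapM pE mcompA -(mcompA s') t's' mcompm1.
have [L [s [t [ts st]]]] := idempotent_split abA pp.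
have [w kw] := kernel_lift fk' (proj1 Sfk).
have [w' kw'] := kernel_lift Sfk (proj1 fk').
(* [S k] factors through [k' = s' \oc e'], which [s' \oc t'] fixes; so [k] factors through [L]. *)
have pk : p \oc k = k.
  apply: (hom_map_inj hU); rewrite -[LHS]/(fmap S _) -[RHS]/(fmap S _).
  by rewrite fmapM pE -kw kse' -!mcompA (mcompA t' s') t's' mcomp1m.
exists K, k; split=> //; exists L, (t \oc k), s; split; last 2 first.
- by exists t.
- by rewrite mcompA st pk.
have km := kernel_mono fk.
split; first by apply: (@mono_cancel _ _ _ _ s); rewrite mcompA st pk.
(* Essentiality of [e'] applies to [S h \oc S t \oc s']: its composite with [e'] is
   [S (h \oc t \oc k) \oc w'], a composite of monomorphisms. *)
move=> P h hem; apply: (hom_map_mono_inv hU).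
(* [S t s' : L' -> S L] and [t' S s : S L -> L'] are mutually inverse. *)
have Shm : mono (fmap S h \oc (fmap S t \oc s')).
  apply: ess'; rewrite -!mcompA -kse' -kw' (mcompA (fmap S t)) -fmapM.
  rewrite mcompA -fmapM; apply: mono_comp; first exact: hom_map_mono.
  by apply: (@mono_cancel _ _ _ _ (fmap S k)); rewrite kw';
    apply: kernel_mono fk'.
have ba : fmap S t \oc s' \oc (t' \oc fmap S s) = idm (S L).
  by rewrite mcompA -(mcompA (fmap S t)) -pE -!fmapM -st mcompA ts
    mcomp1m ts fmap1.
have := mono_comp Shm (@mono_cancel _ _ _ _ _ (t' \oc fmap S s) _).
rewrite -mcompA => /(_ _ (fmap S t \oc s')).
by rewrite ba mcompm1; apply; apply: idm_mono.
Qed.
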